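(* Let $n\ge 2$, $R>0$, and suppose $f\in C^0((0,R))$ and there exists a constant $f_0>0$ such that $f\ge f_0$ on $[0,R]$. Let $u$ denote the convex (classical) solution of problem (P) and, for each $\varepsilon>0$, let $u^\varepsilon$ be the monotone increasing classical solution of problem $(P_\varepsilon)$. Then: (i) $u^0:=\lim_{\varepsilon\to 0^+}u^\varepsilon$ exists pointwise and $u^\varepsilon$ converges to $u^0$ uniformly on every compact subset of $(0,R)$ as $\varepsilon\to0^+$. Moreover, $u^0$ is strictly convex in every compact subset, hence it is strictly convex in $[0,R]$. (ii) $u^\varepsilon_r$ converges to $u^0_r$ weakly-$*$ in $L^\infty((0,R))$ as $\varepsilon\to 0^+$. (iii) $u^0\equiv u$.
   Context: All functions are functions of the radial variable $r\in[0,R]$; subscripts $r$ denote derivatives in $r$. Given $f$ and a number $g(R)\in\mathbb{R}$, problem (P) (the radial form of the Monge–Ampère problem $\det D^2u=f$ in the ball $B_R(0)\subset\mathbb{R}^n$, $u=g$ on the boundary) is: find $u$ with $\frac{1}{n r^{n-1}}\big((u_r)^n\big)_r=f$ in $(0,R)$, $u(R)=g(R)$, $u_r(0)=0$. For $\varepsilon>0$, problem $(P_\varepsilon)$ (the radial form of the vanishing moment approximation $-\varepsilon\Delta^2u^\varepsilon+\det D^2u^\varepsilon=f$, $u^\varepsilon=g$, $\Delta u^\varepsilon=\varepsilon$ on the boundary) is: find $u^\varepsilon$ with $-\frac{\varepsilon}{r^{n-1}}\Big(r^{n-1}\Big(\frac{1}{r^{n-1}}\big(r^{n-1}u^\varepsilon_r\big)_r\Big)_r\Big)_r+\frac{1}{n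 r^{n-1}}\big((u^\varepsilon_r)^n\big)_r=f$ in $(0,R)$, $u^\varepsilon(R)=g(R)$, $u^\varepsilon_r(0)=0$, $|u^\varepsilon_{rr}(0)|<\infty$, $|u^\varepsilon_{rrr}(r)|=o(r^{-(n-1)})$ as $r\to0^+$, and $u^\varepsilon_{rr}(R)+\frac{n-1}{R}u^\varepsilon_r(R)=\varepsilon$. A classical solution is one whose derivatives appearing in the problem exist and satisfy all equations and conditions pointwise. Convexity refers to the function of $r$.
   Formalization: The solution u of (P) is also required to have a finite one-sided derivative u_r(R); without it f may blow up at R so that u_r is unbounded (n=2, R=1, u_r=r(1-r)^{-1/4}), and then (ii) and (iii) cannot both hold. *)

(* Defs.v *)
From HB Require Import structures.
From mathcomp Require Import all_boot all_order all_algebra.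
From mathcomp Require Import all_classical all_reals all_analysis.
Set Implicit Arguments. Unset Strict Implicit. Unset Printing Implicit Defensive.
Import Order.TTheory GRing.Theory Num.Theory.
Import numFieldNormedType.Exports.
Local Open Scope classical_set_scope.
Local Open Scope ring_scope.

Section Defs.
Variable R : realType.

(* g' is the derivative of g on the closed interval [a,b]: two-sided in the
   interior, one-sided at the endpoints (limit of difference quotients within [a,b]). *)
Definition deriv_cc (a b : R) (g g' : R -> R) : Prop :=
  forall x, a <= x <= b ->
    (fun y => (g y - g x) / (y - x)) @ within [set y | a <= y <= b] x^'
      --> g' x.

Definition convex_on (a b : R) (u : R -> R) : Prop :=
  forall x y t, a <= x <= b -> a <= y <= b -> 0 <= t <= 1 ->
    u ((1 - t) * x + t * y) <= (1 - t) * u x + t * u y.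

Definition strictly_convex_on (a b : R) (u : R -> R) : Prop :=
  forall x y t, a <= x <= b -> a <= y <= b -> x != y -> 0 < t < 1 ->
    u ((1 - t) * x + t * y) < (1 - t) * u x + t * u y.

Definition nondecreasing_on (a b : R) (u : R -> R) : Prop :=
  forall x y, a <= x <= b -> a <= y <= b -> x <= y -> u x <= u y.

Definition P_classical (n : nat) (a : R) (f : R -> R) (gR : R) (u : R -> R) : Prop :=
  exists w : R -> R,
    deriv_cc 0 a u w /\
    (forall r, 0 < r < a ->
       let W := fun s => w s ^+ n in
       derivable W r 1 /\
       (n%:R * r ^+ n.-1)^-1 * derive1 W r = f r) /\
    u a = gR /\ w 0 = 0.

Definition Peps_classical (n : nat) (a : R) (f : R -> R) (gR eps : R)
    (u : R -> R) : Prop :=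
  exists w w2 : R -> R,
    deriv_cc 0 a u w /\ deriv_cc 0 a w w2 /\
    (forall r, 0 < r < a -> derivable w2 r 1) /\
    (forall r, 0 < r < a ->
       let A := fun s => s ^+ n.-1 * w s in
       let L := fun s => (s ^+ n.-1)^-1 * derive1 A s in
       let B := fun s => s ^+ n.-1 * derive1 L s in
       let W := fun s => w s ^+ n in
       derivable A r 1 /\ derivable L r 1 /\ derivable B r 1 /\
       derivable W r 1 /\
       - (eps / r ^+ n.-1) * derive1 B r + (n%:R * r ^+ n.-1)^-1 * derive1 W r = f r) /\
    u a = gR /\
    w 0 = 0 /\
    (* |u_rr(0)| < oo holds since w2 0 is a real number *)
    (fun r => r ^+ n.-1 * `| derive1 w2 r |) @ 0^'+ --> 0 /\
    w2 a + (n.-1)%:R / a * w a = eps.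

End Defs.

(* Main.v *)
(** Write [n = m + 2], [v = u'], [w = ueps'].  Integrating the equation of
    (P_eps) once and using (P) gives
      [eps n r^(n-1) L' = w^n - v^n],  where [L = w' + (n-1) w / r];
    the constant of integration vanishes because otherwise [L] would blow up
    at [0] like a logarithm or a negative power of [r], whereas [w / r -> w'(0)].
    This second order equation for [w] obeys a maximum principle.  For each
    point [r] of [0, a], comparing [w] with a steep parabola that lies above
    [v + dlt/2] (below [v - dlt/2]) and takes the value [v r + dlt]
    ([v r - dlt]) at [r] yields [w -> v] uniformly on [0, a] as [eps -> 0].
    Everything else follows from this uniform convergence, and the strict convexity of [u] from [(v^n)' = n r^(n-1) f > 0]. *)

Require Import Defs.
From HB Require Import structures.
From mathcomp Require Import all_boot all_order all_algebra.
From mathcomp Require Import all_classical all_reals all_analysis.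
From mathcomp Require Import measurable_realfun.
From mathcomp Require Import ring lra.
Import Order.TTheory GRing.Theory Num.Theory.
Import numFieldNormedType.Exports.
Local Open Scope classical_set_scope.
Local Open Scope ring_scope.

Set Implicit Arguments.
Unset Strict Implicit.
Unset Printing Implicit Defensive.

(** * Differentiation on a closed interval *)

Section DerivCC.
Variables (R : realType) (a b : R) (g g' : R -> R).
Hypothesis dg : deriv_cc a b g g'.

(** Clearing the denominator admits [y = x] and treats interior points and endpoints alike. *)
Lemma deriv_cc_approx (x e : R) : a <= x <= b -> 0 < e ->
  exists2 d : R, 0 < d & forall y : R, a <= y <= b -> `|y - x| < d ->
    `|g y - g x - g' x * (y - x)| <= e * `|y - x|.
Proof.
move=> xab e0; have /cvgrPdist_lt/(_ e e0) := dg xab.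
rewrite near_withinE near_withinE => -[d /= d0 H]; exists d => // y yab yx.
have [->|yxN] := eqVneq y x; first by rewrite !subrr mulr0 subr0 normr0 mulr0.
have := H y; rewrite /ball_/= distrC => /(_ yx yxN yab) /ltW.
have yx0 : y - x != 0 by rewrite subr_eq0.
rewrite distrC -(ler_pM2r (_ : 0 < `|y - x|)) ?normr_gt0// -normrM.
by rewrite mulrBl divfK.
Qed.

Lemma deriv_cc_near (x e : R) : a <= x <= b -> 0 < e ->
  exists2 d : R, 0 < d & forall y : R, a <= y <= b -> `|y - x| < d -> `|g y - g x| < e.
Proof.
move=> xab e0; have [d d0 H] := deriv_cc_approx xab ltr01.
have K0 : 0 < 1 + `|g' x| by rewrite ltr_pwDl.
exists (Num.min d (e / (1 + `|g' x|))); first by rewrite lt_min d0 divr_gt0.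
move=> y yab; rewrite lt_min => /andP[/(H _ yab) h1].
rewrite ltr_pdivlMr// mulrC; apply: le_lt_trans.
rewrite mulrDl -normrM -[g y - g x](subrK (g' x * (y - x))).
by rewrite (le_trans (ler_normD _ _))// lerD.
Qed.

Lemma deriv_cc_continuous : {within `[a, b], continuous g}.
Proof.
apply/subspace_continuousP => x /=; rewrite in_itv/= => xab.
apply/cvgrPdist_lt => e e0; rewrite near_withinE.
have [d d0 H] := deriv_cc_near xab e0.
exists d => //= y; rewrite /ball_/= distrC => xy; rewrite in_itv/= => yab.
by rewrite distrC H.
Qed.

Lemma deriv_cc_is_derive (x : R) : a < x < b -> is_derive x 1 g (g' x).
Proof.
move=> /andP[ax xb].
have xab : a <= x <= b by rewrite !ltW.
suff H : h^-1 *: (g (h *: 1 + x) - g x) @[h --> 0^'] --> g' x.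
  by split; [apply/cvg_ex; exists (g' x) | apply/cvg_lim].
apply/cvgrPdist_le => e e0.
have [d d0 H] := deriv_cc_approx xab e0.
near=> h.
have hN : h != 0 by near: h; exact: nbhs_dnbhs_neq.
have hd : `|h| < d by near: h; exact: dnbhs0_lt.
have h1 : `|h| < x - a by near: h; apply: dnbhs0_lt; rewrite subr_gt0.
have h2 : `|h| < b - x by near: h; apply: dnbhs0_lt; rewrite subr_gt0.
have := H (h *: 1 + x); rewrite [_ *: 1]mulr1 addrK => /(_ _ hd).
rewrite -ler_pdivrMr ?normr_gt0// -normfV -normrM => H1.
rewrite distrC (le_trans _ (H1 _))//.
  by rewrite mulrBl mulfK// [_ *: _]mulrC.
by move: h1 h2; rewrite !ltr_norml => /andP[? ?] /andP[? ?]; lra.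
Unshelve. all: by end_near. Qed.

Lemma deriv_cc_MVT (x y : R) : a <= x -> x < y -> y <= b ->
  exists2 c : R, x < c < y & g y - g x = g' c * (y - x).
Proof.
move=> ax xy yb; have [] := @MVT R g g' x y xy.
- move=> c; rewrite in_itv/= => /andP[xc cy]; apply: deriv_cc_is_derive.
  by rewrite (le_lt_trans ax xc) (lt_le_trans cy yb).
- apply: continuous_subspaceW deriv_cc_continuous.
  by apply: subset_itv; rewrite bnd_simp.
- by move=> c; rewrite in_itv/= => ?; exists c.
Qed.

End DerivCC.

(** * Maximum principle *)

(** A positive maximum of [D] cannot sit at 0 by sign, nor at [a], where [D1 a < 0] makes [D] larger
    just to the left, nor inside, where [D1 = 0] and [D2 > 0] make [D] increase just to the right.
    The second derivative is examined only at critical points with [D > 0]. *)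
Lemma maximum_principle (R : realType) (a : R) (D D1 : R -> R) :
  deriv_cc 0 a D D1 -> 0 < a -> D 0 <= 0 ->
  (forall r : R, 0 < r < a -> 0 < D r -> D1 r = 0 ->
     exists2 D2 : R, is_derive r 1 D1 D2 & 0 < D2) ->
  (0 < D a -> D1 a < 0) ->
  forall r : R, 0 <= r <= a -> D r <= 0.
Proof.
move=> dD a0 D00 Hint Ha r ra.
have [c + maxc] := EVT_max (ltW a0) (deriv_cc_continuous dD).
rewrite in_itv/= => cab.
apply: (@le_trans _ _ (D c)); first by apply: maxc; rewrite in_itv.
rewrite leNgt; apply/negP => Dc.
have [c0|cN0] := eqVneq c 0; first by move: Dc; rewrite c0 ltNge D00.
have [ca|cNa] := eqVneq c a.
  move: Dc (Ha); rewrite ca => Dc /(_ Dc) D1a.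
  (* Half of the slope pays for the error term, so [D (a - h)] exceeds [D a] by at least
     [- D1 a * h / 2]. *)
  have e0 : 0 < - D1 a / 2 by rewrite divr_gt0// oppr_gt0.
  have aa : 0 <= a <= a by rewrite ltW//=.
  have [d d0 H] := deriv_cc_approx dD aa e0.
  pose h := Num.min (d / 2) a.
  have h0 : 0 < h by rewrite lt_min a0 divr_gt0.
  have hd : h < d by rewrite gt_min; apply/orP; left; lra.
  have ha : h <= a by rewrite ge_min lexx orbT.
  have := H (a - h); have -> : a - h - a = - h by ring.
  rewrite normrN gtr0_norm//.
  have -> : 0 <= a - h <= a by lra.
  move=> /(_ isT hd); rewrite ler_norml => /andP[H1 _].
  have := maxc (a - h); rewrite in_itv/= ca.
  have -> : 0 <= a - h <= a by lra.
  move=> /(_ isT) H2; have P : 0 < - D1 a * h by rewrite mulr_gt0// oppr_gt0.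
  by move: H1 H2; rewrite ?ca; lra.
have c0a : 0 < c < a by move: cab; rewrite !le_eqVlt; move: cN0 cNa; rewrite eq_sym => /negbTE-> /negbTE->.
have Dder : is_derive c 1 D (D1 c) by exact: (deriv_cc_is_derive dD).
have D1c : D1 c = 0.
  have := @derive1_at_max R D 0 a c (ltW a0).
  case.
  - by move=> t; rewrite in_itv/= => t0a; have := deriv_cc_is_derive dD t0a; case.
  - by rewrite in_itv.
  - by move=> t; rewrite in_itv/= => /andP[? ?]; apply: maxc; rewrite in_itv/= !ltW.
  - by move=> _ <-; case: Dder.
have [D2 [dD1 eD2] D2p] := Hint _ c0a Dc D1c.
have [d d0 Hd] : exists2 d : R, 0 < d & forall y, c < y -> y < c + d -> 0 < D1 y.
  have : h^-1 *: (D1 (h *: 1 + c) - D1 c) @[h --> 0^'] --> D2 by rewrite -eD2.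
  move=> /cvgrPdist_lt/(_ _ D2p); rewrite near_withinE => -[d /= d0 H].
  exists d => // y cy ycd.
  have yc0 : 0 < y - c by rewrite subr_gt0.
  have := H (y - c); rewrite /ball_/= sub0r normrN gtr0_norm// ltrBlDl.
  move=> /(_ ycd); rewrite gt_eqF// => /(_ isT).
  rewrite D1c subr0 [_ *: 1]mulr1 subrK ltr_norml => /andP[_].
  rewrite ltrBlDl ltrDr pmulr_rgt0// invr_gt0// => //.
pose y := Num.min (c + d / 2) a.
have cy : c < y by rewrite lt_min; move/andP: c0a => [_ ->]; rewrite andbT; lra.
have yd : y < c + d by rewrite gt_min; apply/orP; left; lra.
have ya : y <= a by rewrite ge_min lexx orbT.
have c0 : 0 <= c by case/andP: cab.
have [z /andP[cz zy] E] := deriv_cc_MVT dD c0 cy ya.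
have Dz : 0 < D1 z by apply: Hd => //; apply: lt_trans yd.
have : D y <= D c by apply: maxc; rewrite in_itv/= ya andbT; apply: le_trans (ltW cy).
suff : 0 < D y - D c by lra.
by rewrite E mulr_gt0// subr_gt0.
Qed.

(** * Convexity, monotone derivatives and uniform continuity *)

Section ConvexDerivative.
Variables (R : realType) (a b : R) (u v : R -> R).
Hypotheses (du : deriv_cc a b u v) (cu : convex_on a b u).

(** If the inequality failed by [e], convexity would carry a defect [t * e] to the point [z] near
    [x], where differentiability allows only [t * e / 2]. *)
Lemma convex_above_tangent (x y : R) : a <= x <= b -> a <= y <= b ->
  v x * (y - x) <= u y - u x.
Proof.
move=> xab yab; have [->|yx] := eqVneq y x; first by rewrite !subrr mulr0.
rewrite leNgt; apply/negP => lt_uv.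
pose e := v x * (y - x) - (u y - u x).
have e0 : 0 < e by rewrite subr_gt0.
have N0 : 0 < `|y - x| by rewrite normr_gt0 subr_eq0.
have [d d0 H] := deriv_cc_approx du xab (divr_gt0 e0 (mulr_gt0 (ltr0Sn _ _) N0) : 0 < e / (2 * `|y - x|)).
pose t := Num.min 1 (d / 2 / `|y - x|).
have t0 : 0 < t by rewrite lt_min ltr01 !divr_gt0.
have t1 : t <= 1 by rewrite ge_min lexx.
have td : t * `|y - x| < d.
  rewrite -ltr_pdivlMr//; apply: (@le_lt_trans _ _ (d / 2 / `|y - x|)).
    by rewrite ge_min lexx orbT.
  by rewrite ltr_pM2r ?invr_gt0//; lra.
pose z := (1 - t) * x + t * y.
have zE : z - x = t * (y - x) by rewrite /z; ring.
have zab : a <= z <= b.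
  by rewrite /z; move: xab yab => /andP[? ?] /andP[? ?]; apply/andP; split; nra.
have := H z zab; rewrite zE normrM (gtr0_norm t0) => /(_ td).
have -> : e / (2 * `|y - x|) * (t * `|y - x|) = t * e / 2.
  by field; rewrite gt_eqF.
rewrite ler_norml => /andP[H1 _].
have := cu xab yab (_ : 0 <= t <= 1); rewrite (ltW t0) t1 => /(_ isT).
rewrite -/z => H2.
have te : 0 < t * e by rewrite mulr_gt0.
have te' : t * e = t * (v x * (y - x)) - t * (u y - u x) by rewrite /e; ring.
by lra.
Qed.

Lemma convex_derivative_nondecreasing : nondecreasing_on a b v.
Proof.
move=> x y xab yab; rewrite le_eqVlt => /predU1P[->//|xy].
have := convex_above_tangent xab yab; have := convex_above_tangent yab xab.
have yx0 : 0 < y - x by rewrite subr_gt0.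
by move=> H1 H2; rewrite -(ler_pM2r yx0); lra.
Qed.

(** A classical solution of (P) is not assumed to have a derivative continuous up to the endpoints;
    convexity provides this. *)
Lemma convex_derivative_continuous (x e : R) : a <= x <= b -> 0 < e ->
  exists2 d : R, 0 < d & forall y : R, a <= y <= b -> `|y - x| < d ->
    `|v y - v x| < e.
Proof.
move=> xab e0.
have [d d0 H] := deriv_cc_approx du xab (divr_gt0 e0 (ltr0Sn _ _) : 0 < e / 4).
(* Half the distance to each endpoint keeps the reflected point in the interval. If [x] is itself an
   endpoint, the default 1 is harmless there: reflection moves away from that endpoint. *)
pose room (s : R) : R := if 0 < s then s / 2 else 1.
have room0 s : 0 < room s by rewrite /room; case: ifP => // ?; rewrite divr_gt0.
exists (Num.min (d / 2) (Num.min (room (b - x)) (room (x - a)))).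
  by rewrite !lt_min divr_gt0//= !room0.
move=> y yab; rewrite !lt_min => /and3P[yd yb ya].
have [->|yx] := eqVneq y x; first by rewrite subrr normr0.
(* The tangent at [y], tested at the reflection [z] of [x] through [y],
   controls [v y - v x] from the correct side. *)
pose z := y + (y - x).
have zx : z - x = 2 * (y - x) by rewrite /z; ring.
have zab : a <= z <= b.
  move: yb ya; rewrite !ltr_norml /room /z.
  case: (ltP 0 (b - x)) => ?; case: (ltP 0 (x - a)) => ?; move=> /andP[? ?] /andP[? ?];
  move: xab yab => /andP[? ?] /andP[? ?]; apply/andP; split; lra.
have Hy := H y yab (_ : _ < d).
have Hz := H z zab (_ : _ < d).
have N0 : 0 < `|y - x| by rewrite normr_gt0 subr_eq0.
have {}Hy := Hy ltac:(lra).
have {}Hz := Hz ltac:(by rewrite zx normrM ger0_norm//; lra).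
have T := convex_above_tangent yab zab.
have zy : z - y = y - x by rewrite /z; ring.
move: Hy Hz T; rewrite zx zy normrM (@ger0_norm _ 2)// !ler_norml.
move=> /andP[Hy _] /andP[_ Hz] T.
(* The errors at [y] and at [z] are [e / 4] times [|y - x|] and times [2 |y - x|], which gives the
   factor 3/4. *)
have main : (v y - v x) * (y - x) <= e * 3 / 4 * `|y - x| by lra.
have [xy|xy|xy] := ltgtP x y; last by rewrite xy eqxx in yx.
  have vv : v x <= v y by apply: convex_derivative_nondecreasing => //; exact: ltW.
  rewrite ger0_norm ?subr_ge0//.
  move: main; rewrite gtr0_norm ?subr_gt0// ler_pM2r ?subr_gt0//; lra.
have vv : v y <= v x by apply: convex_derivative_nondecreasing => //; exact: ltW.
rewrite ler0_norm ?subr_le0//.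
move: main; rewrite ltr0_norm ?subr_lt0// mulrN -mulNr ler_nM2r ?subr_lt0//; lra.
Qed.

End ConvexDerivative.

(** Heine's theorem: the near-covering form of compactness, along [h] tending to 0 from the right,
    merges the local radii into one. *)
Lemma segment_uniformly_continuous (R : realType) (a b : R) (v : R -> R) :
  (forall x e : R, a <= x <= b -> 0 < e ->
     exists2 d : R, 0 < d & forall y : R, a <= y <= b -> `|y - x| < d ->
       `|v y - v x| < e) ->
  forall e : R, 0 < e -> exists2 h : R, 0 < h & forall x y : R,
    a <= x <= b -> a <= y <= b -> `|y - x| < h -> `|v y - v x| < e.
Proof.
move=> cv e e0.
pose P (h x : R) := forall y : R, a <= y <= b -> `|y - x| < h -> `|v y - v x| < e.
have /compact_near_coveringP/near_covering_withinP := @segment_compact R a b.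
move=> /(_ R (0^'+) P _) H.
have : \forall h \near 0^'+, `[a, b] `<=` P h.
  apply: H => x /=; rewrite in_itv/= => xab.
  have [d d0 Hd] := cv x (e / 2) xab (divr_gt0 e0 (ltr0Sn _ _)).
  exists ([set x' | `|x' - x| < d / 2], [set h | 0 < h < d / 2]) => /=.
    split.
      by exists (d / 2); rewrite /= ?divr_gt0// => y; rewrite /ball_/= distrC.
    near=> h; apply/andP; split; near: h; [exact: nbhs_right_gt|].
    by apply: nbhs_right_lt; rewrite divr_gt0.
  move=> [x' h] /= [xx' /andP[h0 hd]]; rewrite in_itv/= => x'ab y yab yx'.
  have H1 : `|v x' - v x| < e / 2 by apply: Hd => //; lra.
  have H2 : `|v y - v x| < e / 2.
    apply: Hd => //; have := ler_normD (y - x') (x' - x).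
    by rewrite addrA subrK; lra.
  have := ler_normB (v y - v x) (v x' - v x).
  have -> : v y - v x - (v x' - v x) = v y - v x' by ring.
  by lra.
move=> Hnear.
have [h [h0 Hh]] : exists h : R, 0 < h /\ `[a, b] `<=` P h.
  near (0 : R)^'+ => h; exists h; split; first by near: h; exact: nbhs_right_gt.
  by near: h.
by exists h => // x y xab yab; apply: Hh => //=; rewrite in_itv.
Unshelve. all: by end_near. Qed.

(** The mean value theorem on both sides of the intermediate point compares two slopes [v c < v d].
    Mean value points are interior, so strict growth on the open interval suffices. *)
Lemma strictly_convex_of_derivative (R : realType) (a b : R) (u v : R -> R) :
  deriv_cc a b u v ->
  (forall x y : R, a < x -> x < y -> y < b -> v x < v y) ->
  strictly_convex_on a b u.
Proof.
move=> du vinc.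
have lt_case (x y t : R) : a <= x -> x < y -> y <= b -> 0 < t < 1 ->
    u ((1 - t) * x + t * y) < (1 - t) * u x + t * u y.
  move=> ax xy yb /andP[t0 t1]; set z := _ + t * y.
  have xz : x < z by rewrite /z; nra.
  have zy : z < y by rewrite /z; nra.
  have zb : z <= b by lra.
  have az : a <= z by lra.
  have [c /andP[xc cz] Ec] := deriv_cc_MVT du ax xz zb.
  have [d /andP[zd dy] Ed] := deriv_cc_MVT du az zy yb.
  have vcd : v c < v d by apply: vinc; lra.
  have : 0 < t * (1 - t) * (y - x) * (v d - v c).
    by rewrite !mulr_gt0// subr_gt0.
  have : (1 - t) * (u z - u x) = v c * (t * (1 - t) * (y - x)) by rewrite Ec /z; ring.
  have : t * (u y - u z) = v d * (t * (1 - t) * (y - x)) by rewrite Ed /z; ring.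
  by lra.
move=> x y t /andP[ax xb] /andP[ay yb] xy t01.
have [?|yx|e] := ltgtP x y; [exact: lt_case| |by rewrite e eqxx in xy].
have t01' : 0 < 1 - t < 1 by lra.
have := lt_case _ _ _ ay yx xb t01'.
by rewrite subKr [t * y + _]addrC [t * u y + _]addrC.
Qed.

(** * First integral of the regularized equation *)

Lemma is_derive_zero_constant (R : realType) (a : R) (G : R -> R) :
  (forall r : R, 0 < r < a -> is_derive r 1 G 0) ->
  forall x y : R, 0 < x < a -> 0 < y < a -> G x = G y.
Proof.
move=> dG; suff lt_case (x y : R) : 0 < x -> x < y -> y < a -> G x = G y.
  move=> x y /andP[x0 xa] /andP[y0 ya].
  by have [?|?|->//] := ltgtP x y; [exact: lt_case|apply/esym; exact: lt_case].
move=> x0 xy ya; have [||c _] := @MVT R G (fun=> 0) x y xy; last by lra.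
- by move=> r; rewrite in_itv/= => /andP[? ?]; apply: dG; lra.
- apply: derivable_within_continuous => r; rewrite in_itv/= => /andP[? ?].
  by have [] := dG r ltac:(lra).
Qed.

(** The function [L - c ln] is nondecreasing near 0, so [L] lies below [c ln s] plus a constant. *)
Lemma log_derivative_unbounded (R : realType) (rho c : R) (L L' : R -> R) :
  0 < rho -> 0 < c ->
  (forall s : R, 0 < s < rho -> is_derive s 1 L (L' s)) ->
  (forall s : R, 0 < s < rho -> c / s <= L' s) ->
  forall M : R, exists2 s1 : R, 0 < s1 & forall s : R, 0 < s < s1 -> L s < M.
Proof.
move=> rho0 c0 dL L'c M.
pose s0 := rho / 2.
have s00 : 0 < s0 by rewrite divr_gt0.
have s0r : s0 < rho by rewrite /s0; lra.
(* Solves [L s0 - c * ln s0 + c * k = M], so that the logarithmic bound falls below [M] once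
   [s < expR k]. *)
pose k := (M - L s0 + c * ln s0) / c.
exists (Num.min s0 (expR k)); first by rewrite lt_min s00 expR_gt0.
move=> s /andP[sp]; rewrite lt_min => /andP[ss0 sk].
pose Q (x : R) := L x - c * ln x.
have dQ x : 0 < x < rho -> is_derive x 1 Q (L' x - c * x^-1).
  move=> x0r; have H1 := dL x x0r; have /andP[x0 _] := x0r.
  have H2 := is_derive1_ln x0.
  exact: is_deriveB.
have [||z] := @MVT R Q (fun x => L' x - c * x^-1) s s0 ss0.
- by move=> x; rewrite in_itv/= => /andP[? ?]; apply: dQ; lra.
- apply: derivable_within_continuous => x; rewrite in_itv/= => /andP[? ?].
  by have [] := dQ x ltac:(lra).
rewrite in_itv/= => /andP[sz zs0] E.
have z0r : 0 < z < rho by apply/andP; split; lra.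
have := L'c z z0r; rewrite -subr_ge0 => P1.
have : 0 <= Q s0 - Q s by rewrite E mulr_ge0// subr_ge0 ltW.
have lnk : c * ln s < c * k by rewrite ltr_pM2l// -[k]expRK ltr_ln ?posrE ?expR_gt0.
have : c * k = M - L s0 + c * ln s0 by rewrite /k mulrC divfK// gt_eqF.
by rewrite /Q; lra.
Qed.

Section FirstIntegral.
Variables (R : realType) (m : nat) (a eps : R) (w w2 v : R -> R).
(** With [w = ueps'] and [n = m.+2], this is the radial Laplacian of [ueps]. *)
Let L (s : R) : R := w2 s + m.+1%:R / s * w s.

Lemma derive_radial (r : R) : 0 < r -> is_derive r 1 w (w2 r) ->
  (r ^+ m.+1)^-1 * derive1 (fun s : R => s ^+ m.+1 * w s) r = L r.
Proof.
move=> r0 dw; rewrite derive1E.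
have dX : is_derive r 1 (fun s : R => s ^+ m.+1) (m.+1%:R * r ^+ m).
  split; first exact: exprn_derivable.
  by rewrite exp_derive [_ *: 1]mulr1.
have [_ ->] := is_deriveM dX dw.
have scaleE (x y : R) : x *: y = x * y by [].
rewrite /L /= !scaleE [r ^+ m.+1]exprS.
by field; rewrite expf_neq0 ?gt_eqF.
Qed.

Hypotheses (a0 : 0 < a) (eps0 : 0 < eps) (dw : deriv_cc 0 a w w2) (w0 : w 0 = 0).

(* [w2 s = w t / t] for some [s] in (0, t), by the mean value theorem. *)
Lemma radial_bounded_near0 :
  exists M : R, forall s1 : R, 0 < s1 ->
    exists2 s : R, 0 < s < s1 & `|L s| <= M.
Proof.
have aa : 0 <= (0 : R) <= a by apply/andP; split=> //; exact: ltW.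
have [d d0 H] := deriv_cc_approx dw aa ltr01.
pose K := 1 + `|w2 0|.
have HK s : 0 < s -> s < d -> s <= a -> `|w s| <= K * s.
  move=> s0 sd sa; have := H s; rewrite w0 !subr0 (gtr0_norm s0) ltW//= sa.
  move=> /(_ isT sd) H1; rewrite -[w s](subrK (w2 0 * s)).
  rewrite (le_trans (ler_normD _ _))// /K mulrDl lerD//.
  by rewrite normrM (gtr0_norm s0).
(* The first [K] bounds [w2 s = w t / t], the second bounds [w s / s]. *)
exists (K + m.+1%:R * K) => s1 s10.
pose t := Num.min (d / 2) (Num.min a s1).
have t0 : 0 < t by rewrite !lt_min a0 s10 divr_gt0.
have td : t < d by rewrite gt_min; apply/orP; left; lra.
have ta : t <= a by rewrite !ge_min lexx orbT.
have ts1 : t <= s1 by rewrite !ge_min lexx !orbT.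
have [s /andP[s0 st]] := deriv_cc_MVT dw (lexx 0) t0 ta.
rewrite w0 !subr0 => E; exists s; first by rewrite s0 (lt_le_trans st).
rewrite (le_trans (ler_normD _ _))// lerD//.
  have := HK t t0 td ta; rewrite E normrM (gtr0_norm t0).
  by rewrite ler_pM2r.
have sd : s < d by lra.
have sa : s <= a by lra.
rewrite normrM normrM normfV (gtr0_norm s0) normr_nat -mulrA ler_wpM2l//.
by rewrite mulrC ler_pdivrMr// HK.
Qed.

Hypotheses (v0 : v 0 = 0) (cv : forall e : R, 0 < e -> exists2 d : R, 0 < d &
  forall y : R, 0 <= y <= a -> `|y - 0| < d -> `|v y - v 0| < e).

(* A nonzero constant would make [L'] comparable to [s^-(m+1)], hence [L]
   unbounded at [0]. *)
Lemma first_integral_constant (C : R) :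
  (forall s : R, 0 < s < a -> is_derive s 1 L
     (((w s ^+ m.+2 - v s ^+ m.+2) / m.+2%:R - C) / (eps * s ^+ m.+1))) ->
  C = 0.
Proof.
move=> dL; apply/eqP; apply: contraT => C0.
have nC : 0 < `|C| by rewrite normr_gt0.
(* Small enough that [w^n] and [v^n] are each at most [|C| / 4], so the constant dominates the
   numerator. *)
pose e : R := Num.min 1 (`|C| / 4).
have e0 : 0 < e by rewrite lt_min ltr01 divr_gt0.
have aa : 0 <= (0 : R) <= a by apply/andP; split=> //; exact: ltW.
have [d1 d10 H1] := deriv_cc_near dw aa e0.
have [d2 d20 H2] := cv e0.
have pow_small x : `|x| < e -> `|x ^+ m.+2| <= `|C| / 4.
  rewrite lt_min => /andP[x1 xC]; rewrite normrX exprS.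
  have : `|x| ^+ m.+1 <= 1 by rewrite exprn_ile1// ltW.
  have := normr_ge0 x; have := exprn_ge0 m.+1 (normr_ge0 x); nra.
pose rho := Num.min (Num.min 1 a) (Num.min d1 d2).
have rho0 : 0 < rho by rewrite !lt_min ltr01 a0 d10 d20.
have rhoP s : s < rho -> [/\ s < 1, s < a, s < d1 & s < d2].
  by rewrite !lt_min => /andP[/andP[-> ->] /andP[-> ->]].
(* This sign makes the derivative of [sg * L] positive near 0 whatever the sign of [C]. *)
pose sg := - Num.sg C.
pose c := `|C| / 2 / eps.
have c0 : 0 < c by rewrite !divr_gt0.
have dsL s : 0 < s < rho -> is_derive s 1 (sg \*: L) (sg *
    (((w s ^+ m.+2 - v s ^+ m.+2) / m.+2%:R - C) / (eps * s ^+ m.+1))).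
  by move=> /andP[s0 /rhoP[_ sa _ _]]; apply: is_deriveZ; apply: dL; rewrite s0.
have Lc s : 0 < s < rho -> c / s <= sg *
    (((w s ^+ m.+2 - v s ^+ m.+2) / m.+2%:R - C) / (eps * s ^+ m.+1)).
  move=> /andP[s0 /rhoP[s1 sa sd1 sd2]].
  have sa' : 0 <= s <= a by rewrite !ltW.
  have wE := H1 s sa'; have vE := H2 s sa'.
  rewrite !subr0 (gtr0_norm s0) w0 subr0 in wE.
  rewrite !subr0 (gtr0_norm s0) v0 subr0 in vE.
  have {}wE := pow_small _ (wE sd1); have {}vE := pow_small _ (vE sd2).
  set X := (_ - _) / m.+2%:R.
  have XC : `|X| <= `|C| / 2.
    rewrite /X normrM normfV normr_nat ler_pdivrMr ?ltr0n//.
    rewrite (le_trans (ler_normB _ _))//.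
    have : 1 <= m.+2%:R :> R by rewrite ler1n.
    by nra.
  have num : `|C| / 2 <= sg * (X - C).
    rewrite /sg mulrBr !mulNr opprK -normrEsg.
    have : `|Num.sg C * X| <= `|C| / 2 by rewrite normrM normr_sg C0 mul1r.
    by rewrite ler_norml => /andP[_]; lra.
  rewrite mulrA /c invfM -[`|C| / 2 / eps / s]mulrA; apply: ler_pM => //.
  - by rewrite mulr_ge0 ?invr_ge0// ltW.
  (* For [s < 1], [s^(m+1) <= s], so the singularity is at least that of [1 / s]. *)
  - rewrite ler_wpM2l ?invr_ge0 ?(ltW eps0)//.
    rewrite lef_pV2 ?posrE ?exprn_gt0// exprS.
    by apply: ler_piMr; [exact: ltW|rewrite exprn_ile1// ltW].
have [M HM] := radial_bounded_near0.
have [s1 s10 Hs1] := log_derivative_unbounded rho0 c0 dsL Lc (- M).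
have [s ss1 LM] := HM s1 s10.
have := Hs1 s ss1; rewrite ltNge /= => /negP; case.
have : `|sg * L s| <= M by rewrite normrM /sg normrN normr_sg C0 mul1r.
by rewrite ler_norml => /andP[].
Qed.

End FirstIntegral.

(** Subtracting the equation of (P) cancels [f] and leaves an exact derivative. The result is a
    second order equation for [w], to which the maximum principle applies. *)
Lemma Peps_classical_first_integral (R : realType) (m : nat) (a : R)
  (f : R -> R) (gR eps : R) (ueps v : R -> R) :
  0 < a -> 0 < eps -> v 0 = 0 ->
  (forall e : R, 0 < e -> exists2 d : R, 0 < d &
    forall y : R, 0 <= y <= a -> `|y - 0| < d -> `|v y - v 0| < e) ->
  (forall r : R, 0 < r < a -> derivable (fun s => v s ^+ m.+2) r 1 /\
    (m.+2%:R * r ^+ m.+1)^-1 * derive1 (fun s => v s ^+ m.+2) r = f r) ->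
  Peps_classical m.+2 a f gR eps ueps ->
  exists w w2 : R -> R,
    [/\ deriv_cc 0 a ueps w, deriv_cc 0 a w w2, w 0 = 0 /\ ueps a = gR,
        w2 a + m.+1%:R / a * w a = eps &
        forall r : R, 0 < r < a ->
          is_derive r 1 (fun s => w2 s + m.+1%:R / s * w s)
            ((w r ^+ m.+2 - v r ^+ m.+2) / (m.+2%:R * eps * r ^+ m.+1))].
Proof.
move=> a0 eps0 v0 cv dv [w [w2 [dw [dw2 [_ [H [ua [w0 [_ bc]]]]]]]]].
exists w, w2; split => //.
pose A := fun s : R => s ^+ m.+1 * w s.
pose L := fun s : R => (s ^+ m.+1)^-1 * derive1 A s.
pose B := fun s : R => s ^+ m.+1 * derive1 L s.
(* The integrated difference of the two equations; its constant value is read off at [a / 2] below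
   and then shown to vanish. *)
pose G := fun s : R => (w s ^+ m.+2 - v s ^+ m.+2) / m.+2%:R - eps * B s.
have dG (r : R) : 0 < r < a -> is_derive r 1 G 0.
  move=> ra; have [_ [_ [dB [dW]]]] := H r ra; have [dV] := dv r ra.
  rewrite -/A -/L -/B !derive1E => E1 E2.
  have HB := derivableP dB; have HW := derivableP dW; have HV := derivableP dV.
  have H1 := is_deriveB (is_deriveZ (m.+2%:R^-1) (is_deriveB HW HV)) (is_deriveZ eps HB).
  have -> : G = (m.+2%:R^-1 \*: ((fun s => w s ^+ m.+2) - (fun s => v s ^+ m.+2))
      - eps \*: B).
    by apply/funext => s; rewrite /G mulrC.
  apply: is_derive_eq H1 _.
  have scaleE (x y : R) : x *: y = x * y by [].
  have /andP[r0 _] := ra.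
  have rN : r ^+ m.+1 != 0 by rewrite expf_neq0// gt_eqF.
  move: E2; rewrite -E1 !scaleE.
  move: ('D_1 B r) ('D_1 (fun s : R => w s ^+ m.+2) r)
    ('D_1 (fun s : R => v s ^+ m.+2) r) => b p q.
  have NN : m.+2%:R != 0 :> R by rewrite pnatr_eq0.
  have lhs (S N x y : R) : S != 0 -> N != 0 ->
      S * (- (eps / S) * x + (N * S)^-1 * y) = - (eps * x) + N^-1 * y.
    by move=> S0 N0; field; rewrite S0 N0.
  have rhs (S N y : R) : S != 0 -> N != 0 -> S * ((N * S)^-1 * y) = N^-1 * y.
    by move=> S0 N0; field; rewrite S0 N0.
  by move/(congr1 (fun x => r ^+ m.+1 * x)); rewrite /= lhs// rhs// mulrBr;
    move: (m.+2%:R^-1 * p) (m.+2%:R^-1 * q) (eps * b) => X Y Z; lra.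
have LE (r : R) : 0 < r < a -> L r = w2 r + m.+1%:R / r * w r.
  move=> ra; have /andP[r0 _] := ra.
  by apply: derive_radial => //; exact: (deriv_cc_is_derive dw2 ra).
have a2 : 0 < a / 2 < a by lra.
have dL (r : R) : 0 < r < a -> is_derive r 1 (fun s => w2 s + m.+1%:R / s * w s)
  (((w r ^+ m.+2 - v r ^+ m.+2) / m.+2%:R - G (a / 2)) / (eps * r ^+ m.+1)).
  move=> ra; have [_ [dLr _]] := H r ra.
  rewrite -(is_derive_zero_constant dG ra a2).
  have /andP[r0 _] := ra.
  have rN : r ^+ m.+1 != 0 by rewrite expf_neq0// gt_eqF.
  have eN : eps != 0 by rewrite gt_eqF.
  have -> : ((w r ^+ m.+2 - v r ^+ m.+2) / m.+2%:R - G r) / (eps * r ^+ m.+1)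
    = 'D_1 L r.
    by rewrite /G subKr /B derive1E; field; rewrite rN eN.
  (* The divergence form [L] and its expansion are known to agree only on (0, a), a neighbourhood of
     [r]. *)
  apply: (near_eq_is_derive _ (derivableP dLr)).
  have : r \in `]0, a[ by rewrite in_itv.
  move=> /near_in_itvoo; apply: filterS => s; rewrite in_itv/= => sa.
  exact: LE.
have C0 := first_integral_constant a0 eps0 dw2 w0 v0 cv dL.
have assoc (X N S : R) : X / N / (eps * S) = X / (N * eps * S).
  by rewrite -mulrA -invfM mulrA.
by move=> r ra; rewrite -assoc; have := dL r ra; rewrite C0 subr0.
Qed.

(** * Parabolic barriers *)

Lemma deriv_cc_of_approx (R : realType) (a b : R) (g g' : R -> R) :
  (forall x e : R, a <= x <= b -> 0 < e ->
    exists2 d : R, 0 < d & forall y : R, a <= y <= b -> `|y - x| < d ->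
      `|g y - g x - g' x * (y - x)| <= e * `|y - x|) ->
  deriv_cc a b g g'.
Proof.
move=> H x xab; apply/cvgrPdist_le => e e0.
have [d d0 Hd] := H x e xab e0.
rewrite near_withinE near_withinE; exists d => // y; rewrite /ball_/= distrC.
move=> yx yxN yab; have := Hd y yab yx.
have yx0 : y - x != 0 by rewrite subr_eq0.
rewrite -ler_pdivrMr ?normr_gt0// -normfV -normrM; apply: le_trans.
by rewrite distrC [X in _ <= `|X|]mulrBl mulfK.
Qed.

(* [sg = 1] gives supersolutions, [sg = -1] subsolutions. *)
Section ParabolaBarrier.
Variables (R : realType) (m : nat) (a : R) (w w2 E : R -> R).
Hypotheses (a0 : 0 < a) (dw : deriv_cc 0 a w w2) (w0 : w 0 = 0).
Hypothesis dL : forall r : R, 0 < r < a ->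
  is_derive r 1 (fun s => w2 s + m.+1%:R / s * w s) (E r).
Variables (sg al be ga : R).
Hypothesis sg2 : sg * sg = 1.
Let psi (s : R) : R := al + be * s + ga * s ^+ 2.

Let D (s : R) : R := sg * (w s - psi s).
Let D1 (s : R) : R := sg * (w2 s - (be + 2 * ga * s)).

Let deriv_cc_D : deriv_cc 0 a D D1.
Proof.
have nsg : `|sg| = 1.
  by apply/eqP; rewrite -sqrp_eq1// -normrX expr2 sg2 normr1.
apply: deriv_cc_of_approx => x e xa e0.
have [d d0 H] := deriv_cc_approx dw xa (divr_gt0 e0 (ltr0Sn _ _) : 0 < e / 2).
have K0 : 0 < 1 + `|ga| by rewrite ltr_pwDl.
(* The parabola deviates from its tangent by exactly [ga * (y - x)^2]; the second radius keeps this
   within [e / 2] times [|y - x|]. *)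
exists (Num.min d (e / 2 / (1 + `|ga|))); first by rewrite lt_min d0 !divr_gt0.
move=> y ya; rewrite lt_min => /andP[/(H _ ya) h1].
rewrite ltr_pdivlMr// => h2.
have -> : D y - D x - D1 x * (y - x) =
  sg * ((w y - w x - w2 x * (y - x)) - ga * (y - x) * (y - x)).
  by rewrite /D /D1 /psi; ring.
rewrite normrM nsg mul1r (le_trans (ler_normB _ _))// !normrM.
have := normr_ge0 (y - x); have := normr_ge0 ga; nra.
Qed.

(** At a critical point [w2] equals the slope of [psi], so [be] cancels and the second derivative of
    [D] is [sg E - (n+1) sg ga + (n-1) (sg al + D) / r^2]. The factor [n+1 = m.+3] is 2 from the
    curvature of [psi] plus [n-1] from the radial term. *)
Let D_convex_at_critical_point (r : R) : 0 < r < a -> 0 <= sg * al ->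
  0 < D r -> D1 r = 0 -> m.+3%:R * (sg * ga) < sg * E r ->
  exists2 D2 : R, is_derive r 1 D1 D2 & 0 < D2.
Proof.
move=> ra al0 Dr D1r big; have /andP[r0 _] := ra.
have rN : r != 0 by rewrite gt_eqF.
have dwr := deriv_cc_is_derive dw ra.
pose q := m.+1%:R * (w2 r / r - w r / r ^+ 2).
have dq : is_derive r 1 (fun s : R => m.+1%:R / s * w s) q.
  have dV : is_derive r 1 (fun s : R => s^-1) (- r ^- 2 *: 1).
    exact: (@is_deriveV R id r 1 1 rN (is_derive_id r 1)).
  have := is_deriveZ m.+1%:R (is_deriveM dV dwr).
  have -> : m.+1%:R \*: ((fun s : R => s^-1) * w) = (fun s : R => m.+1%:R / s * w s).
    by apply/funext => s; rewrite /= -mulrA.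
  move=> H; apply: is_derive_eq H _.
  have scaleE (x y : R) : x *: y = x * y by [].
  by rewrite !scaleE /q; field.
have dw2 : is_derive r 1 w2 (E r - q).
  have := is_deriveB (dL ra) dq.
  by rewrite (_ : _ - _ = w2)//; apply/funext => s /=; exact: addrK.
exists (sg * (E r - q - 2 * ga)).
  have dlin : is_derive r 1 (fun s : R => be + 2 * ga * s) (2 * ga).
    have := is_deriveD (is_derive_cst be r 1) (is_deriveZ (2 * ga) (is_derive_id r 1)).
    by move=> H; apply: is_derive_eq H _; rewrite add0r; exact: mulr1.
  exact: (is_deriveZ sg (is_deriveB dw2 dlin)).
have w2r : w2 r = be + 2 * ga * r.
  have : sg * D1 r = 0 by rewrite D1r mulr0.
  by rewrite /D1 mulrA sg2 mul1r => /eqP; rewrite subr_eq0 => /eqP.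
have wr : w r = psi r + sg * D r.
  by rewrite /D mulrA sg2 mul1r addrC subrK.
have -> : sg * (E r - q - 2 * ga) = sg * E r - m.+3%:R * (sg * ga)
    + m.+1%:R * (sg * al) / r ^+ 2 + m.+1%:R * (sg * sg * D r) / r ^+ 2.
  rewrite /q w2r wr /psi -[m.+3]addn2 natrD -[m.+1]addn1 natrD.
  by field.
have D0 := ltW Dr.
rewrite sg2 mul1r -addrA ltr_pwDl ?subr_gt0// addr_ge0//.
  by apply: divr_ge0; [exact: mulr_ge0|exact: sqr_ge0].
by apply: divr_ge0; [exact: mulr_ge0|exact: sqr_ge0].
Qed.

(** The sign of [sg * al] serves twice: it gives [D 0 <= 0], and it makes the singular term
    [al / r^2] favourable. *)
Lemma parabola_barrier :
  0 <= sg * al ->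
  (forall r : R, 0 < r < a -> 0 < sg * (w r - psi r) ->
    m.+3%:R * (sg * ga) < sg * E r) ->
  (0 < sg * (w a - psi a) -> sg * (w2 a - (be + 2 * ga * a)) < 0) ->
  forall r : R, 0 <= r <= a -> sg * (w r - psi r) <= 0.
Proof.
move=> al0 big bc; apply: (maximum_principle deriv_cc_D a0) => //.
  by rewrite /D w0 /psi expr0n/= !mulr0 !addr0 sub0r mulrN oppr_le0.
by move=> r ra Dr D1r; apply: D_convex_at_critical_point => //; exact: big.
Qed.

End ParabolaBarrier.

(** * Uniform convergence of the derivatives *)

(** Turns a gap between [w] and [v] into a gap between their powers that does not degenerate where
    [v] vanishes. The induction drops nonnegative cross terms. *)
Lemma exprn_superadditive (R : realFieldType) (n : nat) (x t y : R) :
  0 <= x -> 0 <= t -> x + t <= y -> t ^+ n.+1 <= y ^+ n.+1 - x ^+ n.+1.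
Proof.
move=> x0 t0 xty; rewrite lerBrDl.
have : (x + t) ^+ n.+1 <= y ^+ n.+1 by rewrite lerXn2r ?nnegrE//; lra.
apply: le_trans; elim: n => [|n IH]; first by rewrite !expr1.
rewrite [leRHS]exprSr.
have /(ler_wpM2r (_ : 0 <= x + t)) := IH; rewrite addr_ge0// => /(_ isT).
apply: le_trans; rewrite mulrDr !mulrDl -!exprSr.
have : 0 <= t ^+ n.+1 * x by rewrite mulr_ge0// exprn_ge0.
have : 0 <= x ^+ n.+1 * t by rewrite mulr_ge0// exprn_ge0.
by lra.
Qed.

(** Where [w] crosses a barrier it is at least [dlt / 2] away from [v], so the right-hand side is of
    order [1 / eps] and beats the fixed curvature [K]. The threshold [eps0] is chosen before [w] and
    the contact point [r]. *)
Lemma singular_limit_uniform (R : realType) (m : nat) (a : R) (v : R -> R) :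
  0 < a -> v 0 = 0 -> nondecreasing_on 0 a v ->
  (forall e : R, 0 < e -> exists2 h : R, 0 < h & forall x y : R,
    0 <= x <= a -> 0 <= y <= a -> `|y - x| < h -> `|v y - v x| < e) ->
  forall dlt : R, 0 < dlt -> exists2 eps0 : R, 0 < eps0 &
    forall (eps : R) (w w2 : R -> R), 0 < eps -> eps < eps0 ->
      deriv_cc 0 a w w2 -> w 0 = 0 ->
      (forall r : R, 0 < r < a -> 0 <= w r) ->
      w2 a + m.+1%:R / a * w a = eps ->
      (forall r : R, 0 < r < a ->
         is_derive r 1 (fun s => w2 s + m.+1%:R / s * w s)
           ((w r ^+ m.+2 - v r ^+ m.+2) / (m.+2%:R * eps * r ^+ m.+1))) ->
      forall r : R, 0 <= r <= a -> `|w r - v r| <= dlt.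
Proof.
move=> a0 v0 vmon vunif dlt d0.
have [h h0 Hh] := vunif (dlt / 4) (divr_gt0 d0 (ltr0Sn _ _)).
have aa : 0 <= a <= a by rewrite lexx ltW.
have oa : 0 <= (0 : R) <= a by rewrite lexx ltW.
have vpos r : 0 <= r <= a -> 0 <= v r.
  by move=> ra; rewrite -v0; apply: vmon => //; case/andP: ra.
have vmax r : 0 <= r <= a -> v r <= v a.
  by move=> ra; apply: vmon => //; case/andP: ra.
pose V := v a.
have V0 : 0 <= V by exact: vpos.
(* The slope [-C] of the lower barrier makes its boundary value
   [psi' + (n-1) psi / a] negative at [a]; [K] only has to be large. *)
pose C := m.+1%:R / a * V + 1.
have kV0 : 0 <= m.+1%:R / a * V by rewrite mulr_ge0// divr_ge0// ltW.
have C0 : 0 < C by rewrite /C; lra.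
pose K := C ^+ 2 / dlt + 2 * C / h + 2 * V / h ^+ 2 + 1.
have K1 : 0 <= C ^+ 2 / dlt by rewrite divr_ge0 ?exprn_ge0// ltW.
have K2 : 0 <= 2 * C / h by rewrite divr_ge0 ?mulr_ge0// ltW.
have K3 : 0 <= 2 * V / h ^+ 2 by rewrite divr_ge0 ?mulr_ge0 ?exprn_ge0// ltW.
have K0 : 0 < K by rewrite /K; lra.
(* One bound per summand of [K]: [KC] caps the top of the lower barrier, [Kh] absorbs its linear
   term beyond distance [h], and [KV] lets the quadratic term outweigh [V] there. *)
have KC : C ^+ 2 <= K * dlt by rewrite -ler_pdivrMr// /K; lra.
have Kh : 2 * C <= K * h by rewrite -ler_pdivrMr// /K; lra.
have KV : 2 * V <= K * h ^+ 2 by rewrite -ler_pdivrMr ?exprn_gt0// /K; lra.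
have mS0 : 0 < m.+3%:R * K by rewrite mulr_gt0// ltr0n.
have am0 : 0 < a ^+ m.+1 by rewrite exprn_gt0.
have dp0 : 0 < (dlt / 2) ^+ m.+2 by rewrite exprn_gt0// divr_gt0.
have N0 : 0 < m.+2%:R :> R by rewrite ltr0n.
(* Below [eps1] the forcing from a gap [dlt / 2] exceeds [(n+1) K]; the other threshold
   [dlt / 2 / a] is for the upper barrier at [a]. *)
pose eps1 := (dlt / 2) ^+ m.+2 / (m.+2%:R * a ^+ m.+1 * (m.+3%:R * K)).
exists (Num.min eps1 (dlt / 2 / a)).
  by rewrite lt_min !divr_gt0// ?mulr_gt0.
move=> eps w w2 e0; rewrite lt_min => /andP[e1 e2] dw w0 wpos bc dL.
have k1 : 1 <= m.+1%:R :> R by rewrite ler1n.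
have ia0 : 0 < a^-1 by rewrite invr_gt0.
have large (x y r : R) : 0 < r < a -> 0 <= x -> x + dlt / 2 <= y ->
    m.+3%:R * K < (y ^+ m.+2 - x ^+ m.+2) / (m.+2%:R * eps * r ^+ m.+1).
  move=> /andP[r0 ra] x0 xy.
  have P : 0 < m.+2%:R * eps * r ^+ m.+1 by rewrite !mulr_gt0// exprn_gt0.
  rewrite ltr_pdivlMr//.
  have : (dlt / 2) ^+ m.+2 <= y ^+ m.+2 - x ^+ m.+2.
    by apply: exprn_superadditive => //; lra.
  apply: lt_le_trans; move: e1; rewrite /eps1 ltr_pdivlMr ?mulr_gt0//.
  apply: le_lt_trans.
  rewrite [leLHS](_ : _ = eps * m.+2%:R * (m.+3%:R * K) * r ^+ m.+1); last by ring.
  rewrite [leRHS](_ : _ = eps * m.+2%:R * (m.+3%:R * K) * a ^+ m.+1); last by ring.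
  rewrite ler_wpM2l ?lerXn2r ?nnegrE ?(ltW r0) ?(ltW ra) ?(ltW a0)//.
  by rewrite ltW// !mulr_gt0// ltr0n.
have far (t : R) : h <= `|t| -> 2 * V <= K * t ^+ 2.
  move=> ht; apply: le_trans KV _; rewrite ler_wpM2l ?(ltW K0)// -[t ^+ 2]real_normK ?num_real//.
  by rewrite lerXn2r ?nnegrE// ltW.
move=> r ra; have /andP[r0 rla] := ra.
rewrite ler_norml; apply/andP; split.
- pose al := v r - dlt + C * r - K * r ^+ 2.
  pose be := - C + 2 * K * r.
  have psiE s : al + be * s + - K * s ^+ 2 =
      v r - dlt - C * (s - r) - K * (s - r) ^+ 2 by rewrite /al /be; ring.
  have psi_le s : 0 <= s <= a -> al + be * s + - K * s ^+ 2 <= v s - dlt / 2.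
    move=> sa; rewrite psiE.
    (* completing the square: [- C t - K t^2 <= C^2 / (4 K)] *)
    have top : - C * (s - r) - K * (s - r) ^+ 2 <= dlt / 4.
      have sq : 0 <= (2 * K * (s - r) + C) ^+ 2 by exact: sqr_ge0.
      rewrite -(ler_pM2l K0) -subr_ge0.
      rewrite [X in 0 <= X](_ : _ = ((2 * K * (s - r) + C) ^+ 2
        + (K * dlt - C ^+ 2)) / 4); last by field.
      lra.
    have [near|farsr] := ltP `|s - r| h.
      have := Hh r s ra sa near; rewrite ltr_norml => /andP[? _]; lra.
    (* To the right of [r], monotonicity of [v] and [top] suffice; far to the left the quadratic
       term pays for both [V] and the slope. *)
    have [rs|sr] := leP r s; first by have := vmon r s ra sa rs; lra.
    have Kt := far _ farsr.
    move: farsr; rewrite ltr0_norm ?subr_lt0// => hs.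
    have : 2 * C * (r - s) <= K * h * (r - s) by rewrite ler_wpM2r// subr_ge0 ltW.
    have : K * h * (r - s) <= K * (s - r) ^+ 2.
      by rewrite -mulrA ler_wpM2l ?(ltW K0)//; nra.
    have := vmax r ra; have := vpos s sa; rewrite -/V; lra.
  have sg2 : -1 * -1 = 1 :> R by rewrite mulrNN mulr1.
  have al0 : 0 <= -1 * al.
    by have := psi_le 0 oa; rewrite v0 expr0n/= !mulr0 !addr0; lra.
  have Hint s : 0 < s < a -> 0 < -1 * (w s - (al + be * s + - K * s ^+ 2)) ->
      m.+3%:R * (-1 * - K) < -1 * ((w s ^+ m.+2 - v s ^+ m.+2) / (m.+2%:R * eps * s ^+ m.+1)).
    move=> s0a; have sa : 0 <= s <= a by case/andP: s0a => ? ?; rewrite !ltW.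
    move=> Ds; rewrite mulrNN mul1r mulN1r -mulNr opprB; apply: large => //; first exact: wpos.
    by have := psi_le s sa; lra.
  (* If [w a] is below the barrier then [w a <= V], and the boundary condition forces
     [w2 a >= eps - (n-1) V / a], which exceeds the barrier slope, at most [- C]. *)
  have Ha : 0 < -1 * (w a - (al + be * a + - K * a ^+ 2)) ->
      -1 * (w2 a - (be + 2 * - K * a)) < 0.
    move=> Da; have waV : w a <= V by have := psi_le a aa; rewrite /V; lra.
    have : m.+1%:R / a * w a <= m.+1%:R / a * V.
      by rewrite ler_wpM2l// divr_ge0// ltW.
    have : 0 <= K * (a - r) by rewrite mulr_ge0 ?subr_ge0// ltW.
    by rewrite /be /C in C0 *; lra.
  have := parabola_barrier a0 dw w0 dL sg2 al0 Hint Ha ra.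
  by rewrite psiE subrr expr0n/= !mulr0; lra.
- pose al := v r + dlt + K * r ^+ 2.
  pose be := - 2 * K * r.
  have psiE s : al + be * s + K * s ^+ 2 = v r + dlt + K * (s - r) ^+ 2.
    by rewrite /al /be; ring.
  have psi_ge s : 0 <= s <= a -> v s + dlt / 2 <= al + be * s + K * s ^+ 2.
    move=> sa; rewrite psiE.
    have : 0 <= K * (s - r) ^+ 2 by rewrite mulr_ge0 ?sqr_ge0// ltW.
    have [near|farsr] := ltP `|s - r| h.
      have := Hh r s ra sa near; rewrite ltr_norml => /andP[_ ?]; lra.
    have := far _ farsr; have := vmax s sa; have := vpos r ra; rewrite -/V; lra.
  have al0 : 0 <= 1 * al.
    by have := psi_ge 0 oa; rewrite v0 expr0n/= !mulr0 !addr0; lra.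
  have Hint s : 0 < s < a -> 0 < 1 * (w s - (al + be * s + K * s ^+ 2)) ->
      m.+3%:R * (1 * K) < 1 * ((w s ^+ m.+2 - v s ^+ m.+2) / (m.+2%:R * eps * s ^+ m.+1)).
    move=> s0a; have sa : 0 <= s <= a by case/andP: s0a => ? ?; rewrite !ltW.
    move=> Ds; rewrite !mul1r; apply: large => //; first exact: vpos.
    by have := psi_ge s sa; lra.
  (* Above the barrier [w a >= dlt / 2], so [(n-1) w a / a > eps] and [w2 a < 0], whereas the slope
     [2 K (a - r)] is nonnegative. *)
  have Ha : 0 < 1 * (w a - (al + be * a + K * a ^+ 2)) ->
      1 * (w2 a - (be + 2 * K * a)) < 0.
    move=> Da; have wad : dlt / 2 <= w a by have := psi_ge a aa; have := V0; rewrite /V; lra.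
    have : dlt / 2 / a <= m.+1%:R / a * w a.
      rewrite [leRHS]mulrAC ler_wpM2r ?(ltW ia0)//.
      by rewrite (le_trans wad)// ler_peMl// (le_trans _ wad)// ltW// divr_gt0.
    have : 0 <= K * (a - r) by rewrite mulr_ge0 ?subr_ge0// ltW.
    by rewrite /be; lra.
  have := parabola_barrier a0 dw w0 dL (mulr1 1) al0 Hint Ha ra.
  by rewrite psiE subrr expr0n/= !mulr0; lra.
Qed.

(** * From derivatives to functions and integrals *)

(** Supplies the sign of [w] needed to compare powers, since even powers forget it. *)
Lemma nondecreasing_derivative_ge0 (R : realType) (a b : R) (u w : R -> R) :
  nondecreasing_on a b u -> deriv_cc a b u w ->
  forall r : R, a < r < b -> 0 <= w r.
Proof.
move=> umon dw r /andP[ar rb]; rewrite leNgt; apply/negP => wr.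
have rab : a <= r <= b by rewrite !ltW.
have e0 : 0 < - w r / 2 by lra.
have [d d0 H] := deriv_cc_approx dw rab e0.
pose y := Num.min (r + d / 2) b.
have ry : r < y by rewrite lt_min rb andbT; lra.
have yd : y < r + d by rewrite gt_min; apply/orP; left; lra.
have yb : y <= b by rewrite ge_min lexx orbT.
have yab : a <= y <= b by rewrite yb andbT; lra.
have yr0 : 0 < y - r by rewrite subr_gt0.
have := H y yab; rewrite gtr0_norm// ltrBlDl => /(_ yd).
have := umon r y rab yab (ltW ry).
have P : 0 < - w r * (y - r) by rewrite mulr_gt0// oppr_gt0.
by move=> H1; rewrite ler_norml => /andP[_]; lra.
Qed.

Lemma deriv_ccB (R : realType) (a b : R) (g g' k k' : R -> R) :
  deriv_cc a b g g' -> deriv_cc a b k k' ->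
  deriv_cc a b (fun x => g x - k x) (fun x => g' x - k' x).
Proof.
move=> dg dk x xab.
rewrite (_ : (fun y => _) =
  (fun y => (g y - g x) / (y - x) - (k y - k x) / (y - x))).
  exact: cvgB (dg x xab) (dk x xab).
by apply/funext => y; rewrite -mulrBl; congr (_ / _); ring.
Qed.

Lemma close_derivatives_close (R : realType) (a dlt : R) (g g' k k' : R -> R) :
  deriv_cc 0 a g g' -> deriv_cc 0 a k k' -> g a = k a ->
  (forall r : R, 0 <= r <= a -> `|g' r - k' r| <= dlt) ->
  forall r : R, 0 <= r <= a -> `|g r - k r| <= dlt * a.
Proof.
move=> dg dk ga close r /andP[r0 ra].
have dlt0 : 0 <= dlt by apply: le_trans (close 0 _); rewrite // lexx (le_trans r0).
have a0 : 0 <= a := le_trans r0 ra.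
have [->|rNa] := eqVneq r a; first by rewrite ga subrr normr0 mulr_ge0.
have rlta : r < a by rewrite lt_neqAle rNa.
have [c /andP[rc ca]] := deriv_cc_MVT (deriv_ccB dg dk) r0 rlta (lexx a).
rewrite ga subrr sub0r => /(congr1 Num.norm).
rewrite normrN => ->; rewrite normrM ler_pM//; first by apply: close; lra.
by rewrite ger0_norm; lra.
Qed.

Section RintegralClose.
Context {d : measure_display} {T : measurableType d} {R : realType}.
Variables (mu : {measure set T -> \bar R}) (D : set T) (g : T -> R).
Hypotheses (mD : measurable D) (ig : mu.-integrable D (EFin \o g)).

Lemma integrable_bounded_mul (w : T -> R) (M : R) : measurable_fun D w ->
  (forall x, D x -> `|w x| <= M) ->
  mu.-integrable D (EFin \o (fun x => w x * g x)).
Proof.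
move=> mw wM; have mg : measurable_fun D g.
  by apply/measurable_EFinP; exact: measurable_int ig.
apply: (le_integrable mD _ _ (integrableZl mD M ig)).
  by apply/measurable_EFinP; exact: measurable_funM.
move=> x Dx; rewrite /= lee_fin !normrM ler_wpM2r//.
by rewrite (le_trans (wM x Dx))// ler_norm.
Qed.

(** Boundedness of [v], hence of [w], makes both products integrable, so the difference can be taken
    under the integral. *)
Lemma Rintegral_close (w v : T -> R) (M dlt : R) :
  measurable_fun D w -> measurable_fun D v ->
  (forall x, D x -> `|v x| <= M) -> (forall x, D x -> `|w x - v x| <= dlt) ->
  `|Rintegral mu D (fun x => w x * g x) - Rintegral mu D (fun x => v x * g x)|
    <= dlt * Rintegral mu D (fun x => `|g x|).
Proof.
move=> mw mv vM wv.
have wM x : D x -> `|w x| <= dlt + M.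
  move=> Dx; rewrite -[w x](subrK (v x)) (le_trans (ler_normD _ _))//.
  by rewrite lerD ?wv ?vM.
have iw := integrable_bounded_mul mw wM; have iv := integrable_bounded_mul mv vM.
have iwv : mu.-integrable D (EFin \o (fun x => (w x - v x) * g x)).
  exact: integrable_bounded_mul (measurable_funB mw mv) wv.
have ing := integrable_norm ig.
rewrite -RintegralB// -RintegralZl//.
rewrite (@eq_Rintegral _ _ _ _ _ (fun x => (w x - v x) * g x)); last first.
  by move=> x _; rewrite mulrBl.
apply: (le_trans (le_normr_Rintegral mD iwv)).
apply: le_Rintegral => //.
- exact: integrable_norm.
- by apply: eq_integrable (integrableZl mD dlt ing).
- by move=> x Dx; rewrite normrM ler_wpM2r// wv.
Qed.

End RintegralClose.

Lemma measurable_of_continuous_segment (R : realType) (a b : R) (v : R -> R) :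
  (forall x e : R, a <= x <= b -> 0 < e ->
     exists2 d : R, 0 < d & forall y : R, a <= y <= b -> `|y - x| < d ->
       `|v y - v x| < e) ->
  measurable_fun `]a, b[ v.
Proof.
move=> cv; apply: (measurable_funS (E := `[a, b])) => //.
  by apply: subset_itv; rewrite bnd_simp.
apply: subspace_continuous_measurable_fun => //.
apply/subspace_continuousP => x /=; rewrite in_itv/= => xab.
apply/cvgrPdist_lt => e e0; rewrite near_withinE.
have [d d0 H] := cv x e xab e0.
exists d => //= y; rewrite /ball_/= distrC => xy; rewrite in_itv/= => yab.
by rewrite distrC H.
Qed.

Lemma singular_limit_derivatives (R : realType) (m : nat) (a : R) (f : R -> R)
  (gR : R) (u v : R -> R) (ueps : R -> R -> R) :
  0 < a -> deriv_cc 0 a u v -> convex_on 0 a u -> v 0 = 0 ->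
  (forall r : R, 0 < r < a -> derivable (fun s => v s ^+ m.+2) r 1 /\
    (m.+2%:R * r ^+ m.+1)^-1 * derive1 (fun s => v s ^+ m.+2) r = f r) ->
  (forall e : R, 0 < e -> nondecreasing_on 0 a (ueps e) /\
                      Peps_classical m.+2 a f gR e (ueps e)) ->
  forall dlt : R, 0 < dlt -> \forall e \near 0^'+,
    exists w w2 : R -> R, [/\ deriv_cc 0 a (ueps e) w, deriv_cc 0 a w w2,
      ueps e a = gR & forall r : R, 0 <= r <= a -> `|w r - v r| <= dlt].
Proof.
move=> a0 du cu v0 dv Hueps dlt d0.
have cv := @convex_derivative_continuous _ _ _ _ _ du cu.
have oa : 0 <= (0 : R) <= a by rewrite lexx ltW.
have [eps0 e0 H] := singular_limit_uniform m a0 v0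
  (convex_derivative_nondecreasing du cu) (segment_uniformly_continuous cv) d0.
near=> e.
have ep : 0 < e by near: e; exact: nbhs_right_gt.
have elt : e < eps0 by near: e; exact: nbhs_right_lt.
have [umon Pe] := Hueps e ep.
have [w [w2 [dw dw2 [w0 ua] bc dL]]] :=
  Peps_classical_first_integral a0 ep v0 (fun e => cv 0 e oa) dv Pe.
exists w, w2; split => // r ra.
apply: (H e w w2) => //.
exact: nondecreasing_derivative_ge0 umon dw.
Unshelve. all: by end_near. Qed.

(** * Convergence to the convex solution *)

Unset Implicit Arguments.

Theorem theorem3p13 (R : realType) (n : nat) (a : R) (f : R -> R) (f0 gR : R)
  (u : R -> R) (ueps : R -> R -> R) :
  (2 <= n)%N -> 0 < a ->
  {in `]0, a[, continuous f} ->
  0 < f0 -> (forall r, 0 <= r <= a -> f0 <= f r) ->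
  convex_on 0 a u -> P_classical n a f gR u ->
  (forall e, 0 < e -> nondecreasing_on 0 a (ueps e) /\
                      Peps_classical n a f gR e (ueps e)) ->
  exists u0 : R -> R,
    (* (i) pointwise limit on [0,a] *)
    (forall r, 0 <= r <= a -> (fun e => ueps e r) @ 0^'+ --> u0 r) /\
    (* (i) uniform convergence on compact subsets of (0,a) *)
    (forall K : set R, compact K -> K `<=` `]0, a[ ->
       forall eta, 0 < eta -> \forall e \near 0^'+,
         forall r, K r -> `| ueps e r - u0 r | < eta) /\
    (* (i) strict convexity on every compact subset, hence on [0,a] *)
    (forall c d, 0 < c -> d < a -> strictly_convex_on c d u0) /\
    strictly_convex_on 0 a u0 /\
    (* (ii) weak-* convergence of derivatives in L^oo((0,a)) *)
    measurable_fun `]0, a[ (derive1 u0) /\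
    (exists M : R, {ae (@lebesgue_measure R), forall x, x \in `]0, a[ -> `| derive1 u0 x | <= M}) /\
    (forall g : R -> R, (@lebesgue_measure R).-integrable `]0, a[ (EFin \o g) ->
       (fun e => Rintegral (@lebesgue_measure R) `]0, a[ (fun x => derive1 (ueps e) x * g x))
         @ 0^'+ --> Rintegral (@lebesgue_measure R) `]0, a[ (fun x => derive1 u0 x * g x)) /\
    (* (iii) u0 = u *)
    (forall r, 0 <= r <= a -> u0 r = u r).
Proof.
case: n => [//|[//|m]] _ a0 _ f00 ff0 cu [v [du [Hv [ua v0]]]] Hueps.
have near_key := singular_limit_derivatives a0 du cu v0 Hv Hueps.
have vcont := @convex_derivative_continuous _ _ _ _ _ du cu.
have vmon := convex_derivative_nondecreasing du cu.
have aa : 0 <= a <= a by rewrite lexx ltW.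
have oa : 0 <= (0 : R) <= a by rewrite lexx ltW.
have v_ge0 (r : R) : 0 <= r <= a -> 0 <= v r.
  by move=> ra; rewrite -v0; apply: vmon => //; case/andP: ra.
have v_inc (x y : R) : 0 < x -> x < y -> y < a -> v x < v y.
  move=> x0 xy ya; have xa : 0 < x < a by rewrite x0 (lt_trans xy).
  have y0a : 0 < y < a by rewrite ya (lt_trans x0).
  have : v x ^+ m.+2 < v y ^+ m.+2.
    have dU r : r \in `]0, a[%R -> derivable (fun s => v s ^+ m.+2) r 1.
      by rewrite in_itv/= => /Hv[].
    apply: (@gtr0_derive1_lt_oo _ _ 0 a dU) => //; rewrite ?in_itv//=.
      move=> r; rewrite in_itv/= => ra; have [_ E] := Hv r ra.
      have ra' : 0 <= r <= a by case/andP: ra => ? ?; rewrite !ltW.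
      have : 0 < f r by rewrite (lt_le_trans f00)// ff0.
      rewrite -E pmulr_rgt0// invr_gt0 mulr_gt0 ?ltr0n// exprn_gt0//.
      by case/andP: ra.
    move=> r; rewrite inE => ra.
    by apply/differentiable_continuous/derivable1_diffP; exact: dU.
  (* As [v] is nonnegative, the order of the powers determines the order of the values. *)
  apply: contraTT; rewrite -!leNgt => vyx.
  by rewrite lerXn2r ?nnegrE ?v_ge0//; case/andP: xa => ? ?; case/andP: y0a => ? ?; rewrite !ltW.
have sc : strictly_convex_on 0 a u by exact: strictly_convex_of_derivative du v_inc.
have unif (eta : R) : 0 < eta -> \forall e \near 0^'+,
    forall r : R, 0 <= r <= a -> `|ueps e r - u r| < eta.
  move=> eta0; have d0 : 0 < eta / 2 / a by rewrite !divr_gt0.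
  apply: filterS (near_key _ d0) => e [w [w2 [dw _ uea close]]] r ra.
  have := close_derivatives_close dw du (etrans uea (esym ua)) close ra.
  by rewrite divfK ?gt_eqF//; lra.
have inoo (r : R) : r \in `]0, a[ -> 0 <= r <= a.
  by rewrite in_itv/= => /andP[? ?]; rewrite !ltW.
(* [derive1] is two-sided, so it is matched with the closed-interval derivative only on the open
   interval, the domain of the integrals. *)
have derE (g g' : R -> R) : deriv_cc 0 a g g' -> {in `]0, a[%classic, derive1 g =1 g'}.
  move=> dg r; rewrite inE/= in_itv/= => ra.
  by rewrite derive1E; have [_ ->] := deriv_cc_is_derive dg ra.
have mv : measurable_fun `]0, a[ v by exact: measurable_of_continuous_segment.
have v_bound (r : R) : 0 <= r <= a -> `|v r| <= v a.
  by move=> ra; rewrite ger0_norm ?v_ge0// vmon//; case/andP: ra.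
exists u; split; [|split; [|split; [|split; [|split; [|split; [|split]]]]]] => //.
- move=> r ra; apply/cvgrPdist_lt => eta eta0.
  by apply: filterS (unif _ eta0) => e H; rewrite distrC H.
- move=> K _ Koo eta eta0; apply: filterS (unif _ eta0) => e H r /Koo /= ra.
  exact/H/inoo.
- move=> c d c0 da x y t /andP[cx xd] /andP[cy yd]; apply: sc; lra.
- by apply: eq_measurable_fun mv => r ra; rewrite (derE _ _ du).
- exists (v a); apply: aeW => r ra.
  by rewrite (derE _ _ du) ?v_bound ?inoo//; rewrite inE.
- move=> g ig; apply/cvgrPdist_lt => eta eta0.
  pose N := Rintegral (@lebesgue_measure R) `]0, a[ (fun x => `|g x|).
  have N0 : 0 <= N by apply: Rintegral_ge0.
  (* The added 1 covers the case where the norm [N] of [g] is zero. *)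
  have d0 : 0 < eta / 2 / (N + 1) by rewrite !divr_gt0// ltr_pwDr.
  apply: filterS (near_key _ d0) => e [w [w2 [dw dw2 _ close]]].
  have EqR (k k' : R -> R) : deriv_cc 0 a k k' ->
      Rintegral (@lebesgue_measure R) `]0, a[ (fun x => derive1 k x * g x) =
      Rintegral (@lebesgue_measure R) `]0, a[ (fun x => k' x * g x).
    by move=> dk; apply: eq_Rintegral => r ra; rewrite (derE _ _ dk).
  rewrite (EqR _ _ du) (EqR _ _ dw).
  have mw : measurable_fun `]0, a[ w.
    by apply: measurable_of_continuous_segment => x e'; exact: (deriv_cc_near dw2).
  have inD (r : R) : `]0, a[%classic r -> 0 <= r <= a by exact: inoo.
  rewrite distrC; apply: le_lt_trans.
    exact: (Rintegral_close _ ig mw mv (fun x Dx => v_bound x (inD x Dx))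
      (fun x Dx => close x (inD x Dx))).
  rewrite -/N mulrAC ltr_pdivrMr ?ltr_pwDr// mulrDr mulr1.
  have : eta / 2 * N <= eta * N by rewrite ler_wpM2r//; lra.
  by lra.
Qed.
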